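(* Let $n\ge 1$ be an integer and let $P$ be a positive integer. Put $P_j=P+2(j-1)$ for $1\le j\le 2^n$. Then the $2^n\times n$ binary matrix whose $j$-th row is $(\mathbf{i}_1(P_j),\mathbf{i}_2(P_j),\dots,\mathbf{i}_n(P_j))$ is a complete table of binary arrangements: every word in $\{0,1\}^n$ occurs as one of its $2^n$ rows (hence exactly once). Equivalently, the corresponding table with two colours (one colour for odd, another for even) contains all colour arrangements with repetition of length $n$.
   Context: The Collatz map on positive integers is $T(N)=N/2$ if $N$ is even and $T(N)=(3N+1)/2$ if $N$ is odd; $T_k$ denotes its $k$-fold iterate. The parity indicator is $\mathbf{i}_k(P)=1$ if $T_k(P)$ is odd and $0$ otherwise. The matrix in the claim is called the structural binary matrix of the perfect chromoform of dimensional order $n$ with generating sequence $(P,P+2,\dots,P+2(2^n-1))$. *)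

(* Defs.v *)
From HB Require Import structures.
From mathcomp Require Import all_boot all_algebra.

Set Implicit Arguments.
Unset Strict Implicit.
Unset Printing Implicit Defensive.

(* Positive integers are the nonzero elements of nat;
   the extra value collatz 0 = 0 is never reached from a positive argument. *)
Definition collatz (N : nat) : nat :=
  if odd N then (3 * N + 1) %/ 2 else N %/ 2.

Definition collatz_iter (k N : nat) : nat := iter k collatz N.

(* The set {0,1} is bool, with true for 1 and false for 0. *)
Definition parity_ind (k N : nat) : bool := odd (collatz_iter k N).

(* Rows and columns are indexed from 0: row j is attached to the term
   P + 2 * j of the generating sequence, and column k holds the parity of the
   iterate of order k.+1, so that the columns run over the orders 1, ..., n. *)
Definition gen_term (P j : nat) : nat := P + 2 * j.

Definition structural_matrix (n P : nat) : 'M[bool]_(2 ^ n, n) :=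
  (\matrix_(j < 2 ^ n, k < n) parity_ind k.+1 (gen_term P j))%R.

Definition colour_table (C : Type) (c_odd c_even : C) (n P : nat) :
    'M[C]_(2 ^ n, n) :=
  (\matrix_(j < 2 ^ n, k < n)
     if odd (collatz_iter k.+1 (gen_term P j)) then c_odd else c_even)%R.

Definition complete_binary_table (m n : nat) (M : 'M[bool]_(m, n)) : Prop :=
  forall w : 'rV[bool]_n, exists j : 'I_m, row j M = w.

Definition complete_colour_table (C : Type) (c1 c2 : C) (m n : nat)
    (M : 'M[C]_(m, n)) : Prop :=
  forall w : 'rV[C]_n, (forall k : 'I_n, w ord0 k = c1 \/ w ord0 k = c2) ->
  exists j : 'I_m, row j M = w.

(* Main.v *)
Require Import Defs.
From HB Require Import structures.
From mathcomp Require Import all_boot all_algebra.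
From mathcomp Require Import zify.

(** The parities of [M], [T M], ..., [T^(n-1) M] determine [M] modulo [2 ^ n],
    because [M] is recovered modulo [2 ^ n] from its parity and from [T M]
    modulo [2 ^ (n - 1)]. Since all the terms [P + 2 j] have the same parity,
    [T (P + 2 j) = T P + a j] with [a] equal to [1] or [3]; as [a] is odd, these
    are pairwise distinct modulo [2 ^ n] for [j < 2 ^ n]. The rows of the
    matrix are thus pairwise distinct, and there are as many of them as words. *)

Lemma eqn_mod_cancel (d a m n : nat) : coprime d a ->
  a * m = a * n %[mod d] -> m = n %[mod d].
Proof.
move=> cop; wlog le_nm : m n / n <= m => [hw|].
  by case: (leqP n m) => [|/ltnW] /hw h e; [apply: h | symmetry; apply: h].
move/eqP; rewrite eqn_mod_dvd ?leq_mul2l ?le_nm ?orbT //.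
by rewrite -mulnBr Gauss_dvdr // -eqn_mod_dvd // => /eqP.
Qed.

(** Doubling clears the floor division and leaves affine expressions, suited to congruences. *)
Lemma double_collatz (N : nat) :
  2 * collatz N = if odd N then 3 * N + 1 else N.
Proof. by rewrite /collatz; case: ifP => oN; lia. Qed.

Lemma collatz_addn_double (P j : nat) :
  collatz (P + 2 * j) = collatz P + (if odd P then 3 else 1) * j.
Proof.
have := double_collatz (P + 2 * j); have := double_collatz P.
by rewrite oddD oddM /= addbF; case: (odd P); lia.
Qed.

Lemma eq_parity_mod (n M N : nat) :
  (forall k, k < n -> parity_ind k M = parity_ind k N) -> M = N %[mod 2 ^ n].
Proof.
elim: n M N => [|n IHn] M N eqMN; first by rewrite !modn1.
have oMN : odd M = odd N by apply: (eqMN 0).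
have /IHn eqT k : k < n -> parity_ind k (collatz M) = parity_ind k (collatz N).
  move=> lt_kn; have := eqMN k.+1 lt_kn.
  by rewrite /parity_ind /collatz_iter !iterSr.
(* Doubling lifts the congruence modulo [2 ^ n] to one modulo [2 ^ n.+1]. *)
have : 2 * collatz M = 2 * collatz N %[mod 2 ^ n.+1].
  by rewrite expnS -!muln_modr eqT.
rewrite !double_collatz oMN; case: (odd N) => // /eqP.
rewrite eqn_modDr => /eqP; apply: eqn_mod_cancel.
by rewrite coprimeXl.
Qed.

Lemma row_structural_matrix_inj (n P : nat) :
  injective (fun j => row j (structural_matrix n P)).
Proof.
move=> i j /rowP eq_ij.
(* Columns start at order 1, so a row lists the parities of orders below [n] for the image of its
   term under [collatz]. *)
have /eq_parity_mod : forall k, k < n ->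
    parity_ind k (collatz (P + 2 * i)) = parity_ind k (collatz (P + 2 * j)).
  move=> k lt_kn; have := eq_ij (Ordinal lt_kn).
  by rewrite !mxE /parity_ind /collatz_iter !iterSr.
rewrite !collatz_addn_double => /eqP; rewrite eqn_modDl => /eqP.
have cop : coprime (2 ^ n) (if odd P then 3 else 1).
  by rewrite coprimeXl //; case: (odd P).
by move/(eqn_mod_cancel _ _ _ _ cop); rewrite !modn_small // => /val_inj.
Qed.

Lemma structural_matrix_complete (n P : nat) :
  complete_binary_table (structural_matrix n P).
Proof.
move=> w; have [|g _ gK] := inj_card_bij (@row_structural_matrix_inj n P).
  by rewrite card_mx card_bool card_ord mul1n.
by exists (g w); apply: gK.
Qed.

Theorem theorem8p1 (n P : nat) (hn : 1 <= n) (hP : 0 < P) :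
  [/\ complete_binary_table (structural_matrix n P),
      (forall w : 'rV[bool]_n,
         exists! j : 'I_(2 ^ n), row j (structural_matrix n P) = w)
    & forall (C : Type) (c_odd c_even : C), c_odd <> c_even ->
         complete_colour_table c_odd c_even (colour_table c_odd c_even n P)].
Proof.
have complete := structural_matrix_complete n P; split=> // [w|C c1 c2 _ w wP].
  have [j rj] := complete w; exists j; split=> // i ri.
  by apply: (@row_structural_matrix_inj n P); rewrite rj ri.
have [b bP] : exists b : 'rV[bool]_n,
    forall k, w ord0 k = if b ord0 k then c1 else c2.
  (* Equality on [C] need not be decidable, so the bits come from finite choice over the positions,
     not from a comparison. *)
  have [|f fP] := fin_all_exists (P := fun k b => w ord0 k = if b then c1 else c2).
    by move=> k; case: (wP k) => ->; [exists true | exists false].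
  by exists (\row_k f k)%R => k; rewrite mxE.
have [j /rowP rj] := complete b; exists j; apply/rowP=> k.
by rewrite bP -rj !mxE.
Qed.
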